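(* For every $0<\eta<1$ and positive integers $N$ and $M$, there exists a couple $(X,Y)$ and a dictionary $F=\{f_1,\ldots,f_M\}$ with the following properties: 1. $|Y|\le1$ almost surely and $|f(X)|\le1$ almost surely for every $f\in F$. 2. With probability at least $\eta$, for every $\kappa>0$ there is some $$\hat f\in\operatorname{arg\,min}_{f\in\operatorname{span}(F)}\frac1N\sum_{i=1}^N(Y_i-f(X_i))^2$$ for which $$R(\hat f)\ge\inf_{f\in\operatorname{span}(F)}R(f)+\kappa.$$
   Context: $X$ is a random variable with values in a measurable space $\mathcal{X}$ and $Y$ is a real-valued random variable. $(X_i,Y_i)_{i=1}^N$ are $N$ independent copies of $(X,Y)$, and probability in item 2 refers to this sample. A dictionary $F=\{f_1,\ldots,f_M\}$ is a set of $M$ real-valued measurable functions on $\mathcal{X}$, and $\operatorname{span}(F)=\{\sum_{j=1}^Mt_jf_j:t\in\mathbb{R}^M\}$. The risk is $R(f)=\mathbb{E}(Y-f(X))^2$; for a sample-dependent $\hat f$, $R(\hat f)=\mathbb{E}\bigl((Y-\hat f(X))^2\mid(X_i,Y_i)_{i=1}^N\bigr)$ with $(X,Y)$ independent of the sample. *)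

(* Defs.v *)
From HB Require Import structures.
From mathcomp Require Import all_boot all_order all_algebra.
From mathcomp Require Import all_classical all_reals all_analysis.
From mathcomp Require Import measurable_realfun.

Set Implicit Arguments.
Unset Strict Implicit.
Unset Printing Implicit Defensive.

Import Order.TTheory GRing.Theory Num.Theory.
Import numFieldNormedType.Exports.

Local Open Scope classical_set_scope.
Local Open Scope ring_scope.

Section Independence.
Context {R : realType} {d d' : measure_display}
  {Omega : measurableType d} {T : measurableType d'}.

Definition mutually_independent (I : finType) (P : probability Omega R)
    (Z : I -> Omega -> T) : Prop :=
  forall (J : {set I}) (B : I -> set T), (forall i, measurable (B i)) ->
    (P (\bigcap_(i in [set` J]) (Z i @^-1` B i)) =
     \prod_(i in J) P (Z i @^-1` B i))%E.

End Independence.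

Definition same_law {R : realType} {d d1 d2 : measure_display}
    {T : measurableType d} {Omega1 : measurableType d1}
    {Omega2 : measurableType d2} (P1 : probability Omega1 R)
    (P2 : probability Omega2 R) (Z1 : Omega1 -> T) (Z2 : Omega2 -> T) : Prop :=
  forall B : set T, measurable B -> P1 (Z1 @^-1` B) = P2 (Z2 @^-1` B).

(* (Xs i, Ys i), i < N, are N independent copies of (X, Y).  The copies may
   live on a probability space other than that of (X, Y). *)
Definition iid_copies {R : realType} {dX d d' : measure_display}
    {XX : measurableType dX} {Omega : measurableType d}
    {Omega' : measurableType d'}
    (P : probability Omega R) (X : {RV P >-> XX}) (Y : {RV P >-> R})
    (N : nat) (P' : probability Omega' R)
    (Xs : 'I_N -> {RV P' >-> XX}) (Ys : 'I_N -> {RV P' >-> R}) : Prop :=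
  (forall i, same_law P' P (fun w => (Xs i w, Ys i w)) (fun w => (X w, Y w)))
  /\ mutually_independent P' (fun i w => (Xs i w, Ys i w)).

Definition dict_span {R : realType} {U : Type} (M : nat)
    (f : 'I_M -> U -> R) : set (U -> R) :=
  [set g | exists t : 'I_M -> R, g = fun x => \sum_(j < M) t j * f j x].

Section Risk.
Context {R : realType} {dX d : measure_display}
  {XX : measurableType dX} {Omega : measurableType d}.

(* For a sample-dependent g this is used at the realized function g, which is
   the conditional expectation given the sample; see [conditional_riskE]. *)
Definition risk (P : probability Omega R) (X : {RV P >-> XX})
    (Y : {RV P >-> R}) (g : XX -> R) : \bar R :=
  ('E_P[fun w => ((Y w - g (X w)) ^+ 2)%R])%E.

End Risk.

Definition empirical_risk {R : realType} {U : Type} (N : nat)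
    (x : 'I_N -> U) (y : 'I_N -> R) (g : U -> R) : R :=
  N%:R^-1 * \sum_(i < N) (y i - g (x i)) ^+ 2.

Definition argmin_on {R : realType} {G : Type} (S : set G) (L : G -> R) : set G :=
  [set g | S g /\ forall h, S h -> L g <= L h].

(* (X, Y) and the sample are made independent by putting them on the two
   factors of P' \x P; ghat w' is the function chosen at the sample point w'. *)
Lemma conditional_riskE {R : realType} {dX d d' : measure_display}
    {XX : measurableType dX} {Omega : measurableType d}
    {Omega' : measurableType d'}
    (P : probability Omega R) (X : {RV P >-> XX}) (Y : {RV P >-> R})
    (P' : probability Omega' R) (ghat : Omega' -> XX -> R)
    (mghat : measurable_fun setT (fun z : Omega' * XX => ghat z.1 z.2))
    (A : set Omega') (mA : measurable A) :
  (\int[P' \x P]_(z in A `*` setT) ((Y z.2 - ghat z.1 (X z.2)) ^+ 2)%:E =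
   \int[P']_(w' in A) risk X Y (ghat w'))%E.
Proof.
have mF : measurable_fun setT
    (EFin \o (fun z : Omega' * Omega => (Y z.2 - ghat z.1 (X z.2)) ^+ 2)).
  apply/measurable_EFinP; apply: measurable_funX; apply: measurable_funB.
    exact: measurableT_comp.
  have -> : (fun z : Omega' * Omega => ghat z.1 (X z.2)) =
      (fun z : Omega' * XX => ghat z.1 z.2) \o (fun z => (z.1, X z.2)) by [].
  apply: measurableT_comp => //; apply/measurable_fun_pairP; split.
    exact: measurable_fst.
  exact: measurableT_comp (measurable_snd).
rewrite integral_mkcond fubini_tonelli1/=; last 2 first.
- apply/(measurable_restrictT _ _).1 => //; first exact: measurableX.
  exact: measurable_funTS.
- by move=> z; apply: erestrict_ge0 => ? _; rewrite lee_fin sqr_ge0.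
rewrite [RHS]integral_mkcond; apply: eq_integral => w' _.
rewrite /fubini_F /risk unlock [RHS]/patch; case: ifPn => w'A.
  apply: eq_integral => w _; rewrite /patch ifT//.
  by rewrite inE; split=> //=; rewrite inE in w'A.
rewrite integral0_eq// => w _; rewrite /patch ifF//.
apply/negbTE; apply: contra w'A; rewrite !inE; by case.
Qed.

Lemma product_copies_exist {R : realType} {d d' : measure_display}
    {Omega : measurableType d} {T : measurableType d'}
    (P : probability Omega R) (Z : {mfun Omega >-> T}) (N : nat) :
  exists (d1 : measure_display) (Omega' : measurableType d1)
    (P' : probability Omega' R) (Zs : 'I_N -> {mfun Omega' >-> T}),
    forall B : 'I_N -> set T, (forall i, measurable (B i)) ->
      (P' (\bigcap_i (Zs i @^-1` B i)) = \prod_(i < N) P (Z @^-1` B i))%E.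
Proof.
elim: N => [|N [d1 [ Omega' [P' [Zs ind]]]]].
  exists d, Omega, P, (fun=> Z) => B mB.
  rewrite big_ord0 (_ : \bigcap_i _ = setT) ?probability_setT//.
  by rewrite -subTset => w _ [].
pose Zs1 (i : 'I_N.+1) (z : Omega' * Omega) : T :=
  if unlift ord0 i is Some j then Zs j z.1 else Z z.2.
have mZs1 i : measurable_fun setT (Zs1 i).
  by rewrite /Zs1; case: (unlift ord0 i) => [j|]; exact: measurableT_comp.
pose Zs2 i : {mfun (Omega' * Omega)%type >-> T} :=
  HB.pack_for {mfun (Omega' * Omega)%type >-> T} (Zs1 i)
    (isMeasurableFun.Build _ _ _ _ _ (mZs1 i)).
exists _, _, (P' \x P)%E, Zs2 => B mB.
have -> : \bigcap_i (Zs2 i @^-1` B i) =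
    (\bigcap_j (Zs j @^-1` B (lift ord0 j))) `*` (Z @^-1` B ord0).
  apply/seteqP; split => [z Bz|z [/= Bz1 Bz2] i _].
    split => [j _|] /=.
      by have := Bz (lift ord0 j) Logic.I; rewrite /= /Zs1 liftK.
    by have := Bz ord0 Logic.I; rewrite /= /Zs1 unlift_none.
  rewrite /= /Zs1; case: unliftP => [j ij|->]; last exact: Bz2.
  by rewrite ij; exact: (Bz1 j Logic.I).
have mpre (j : 'I_N.+1) d0 (U : measurableType d0) (W : {mfun U >-> T}) :
    measurable (W @^-1` B j).
  by rewrite -[X in measurable X]setTI; exact: measurable_funP.
apply: etrans.
  apply: product_measure1E; last exact: mpre.
  by apply: fin_bigcap_measurable => // j _; exact: mpre.
transitivity ((\prod_(i < N) P (Z @^-1` B (lift ord0 i))) * P (Z @^-1` B ord0))%E.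
  by congr (_ * _)%E; exact: ind.
by rewrite big_ord_recl muleC.
Qed.

Lemma iid_copies_exist {R : realType} {dX d : measure_display}
    {XX : measurableType dX} {Omega : measurableType d}
    (P : probability Omega R) (X : {RV P >-> XX}) (Y : {RV P >-> R}) (N : nat) :
  exists (d' : measure_display) (Omega' : measurableType d')
    (P' : probability Omega' R)
    (Xs : 'I_N -> {RV P' >-> XX}) (Ys : 'I_N -> {RV P' >-> R}),
    iid_copies X Y Xs Ys.
Proof.
have mZ : measurable_fun setT (fun w => (X w, Y w)).
  by apply/measurable_fun_pairP; split; exact: measurable_funP.
pose Z : {mfun Omega >-> (XX * R)%type} :=
  HB.pack_for {mfun Omega >-> (XX * R)%type} (fun w => (X w, Y w))
    (isMeasurableFun.Build _ _ _ _ _ mZ).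
have [d' [ Omega' [P' [Zs ZsE]]]] := product_copies_exist P Z N.
have mX i : measurable_fun setT (fst \o Zs i) by exact: measurableT_comp.
have mY i : measurable_fun setT (snd \o Zs i : Omega' -> R).
  exact: measurableT_comp.
exists d', Omega', P',
  (fun i => HB.pack_for {mfun Omega' >-> XX} (fst \o Zs i)
    (isMeasurableFun.Build _ _ _ _ _ (mX i))),
  (fun i => HB.pack_for {mfun Omega' >-> R} (snd \o Zs i)
    (isMeasurableFun.Build _ _ _ _ _ (mY i))).
have pairE i : (fun w => ((fst \o Zs i) w, (snd \o Zs i) w)) = Zs i :> (_ -> _).
  by apply/funext => w /=; rewrite -surjective_pairing.
have sub (J : {set 'I_N}) B : (forall i, measurable (B i)) ->
    (P' (\bigcap_(i in [set` J]) (Zs i @^-1` B i)) =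
     \prod_(i in J) P (Z @^-1` B i))%E.
  move=> mB; pose B' i := if i \in J then B i else setT.
  have -> : \bigcap_(i in [set` J]) (Zs i @^-1` B i) =
      \bigcap_i (Zs i @^-1` B' i).
    apply/seteqP; split => [w Bw i _|w Bw i /= iJ].
      by rewrite /= /B'; case: ifPn => // iJ; exact: Bw.
    by have := Bw i Logic.I; rewrite /= /B' iJ.
  rewrite ZsE; last by move=> i; rewrite /B'; case: ifPn.
  rewrite [RHS]big_mkcond; apply: eq_bigr => i _; rewrite /B'.
  by case: ifPn => // _; rewrite preimage_setT probability_setT.
have law i B : measurable B -> P' (Zs i @^-1` B) = P (Z @^-1` B).
  move=> mB; have := sub [set i]%SET (fun=> B) (fun=> mB).
  rewrite big_set1 => <-; congr (P' _); apply/seteqP; split => [w Bw j|w].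
    by rewrite /= inE => /eqP ->.
  by apply => /=; rewrite inE.
split => [i B mB|J B mB] /=; first by rewrite pairE; exact: law.
under eq_bigcapr do rewrite pairE.
rewrite sub//; apply: eq_bigr => i _.
by rewrite -(law i)// pairE.
Qed.

(* Main.v *)
Require Import Defs.
From HB Require Import structures.
From mathcomp Require Import all_boot all_order all_algebra.
From mathcomp Require Import all_classical all_reals all_analysis.
From mathcomp Require Import lra.

(** Least squares cannot learn the value of a function at a point that the
    sample does not visit. The point [true] is given a small mass [1 - q] by a
    Bernoulli variable [X] on the two-point space [bool], the response [Y] is
    zero, and every dictionary function is a multiple of the indicator of
    [true], so that the span is the line of the functions vanishing at [false].
    For such a [g], [risk_coin] gives the risk [(1 - q) * g true ^+ 2]: the
    infimum over the span is [0], and the risk is unbounded along the span.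

    If the whole sample sits at [false], all functions of the span have the
    same empirical risk, so all are minimizers ([argmin_unidentified]), and
    some have a risk as large as desired. If [true] is sampled at least once,
    the value at [true] of a minimizer is bounded in terms of the observed
    responses ([argmin_sqr_le]), and so is its risk. Hence the event of the
    theorem is exactly the event that no [X_i] equals [true]
    ([arbitrarily_bad_argminP]). In particular it is measurable, and by
    independence its probability is [q ^+ N], which equals [eta] when [q] is
    the [N]-th root of [eta]. *)

Set Implicit Arguments.
Unset Strict Implicit.
Unset Printing Implicit Defensive.

Import Order.TTheory GRing.Theory Num.Theory.
Import numFieldNormedType.Exports.

Local Open Scope classical_set_scope.
Local Open Scope ring_scope.

Lemma exists_root_in_unit_interval (R : realType) (eta : R) (N : nat) :
  0 < eta -> eta < 1 -> (0 < N)%N ->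
  exists q : R, [/\ 0 < q, q < 1 & q ^+ N = eta].
Proof.
move=> eta_gt0 eta_lt1 N_gt0; pose q := eta `^ (N%:R^-1).
have q_gt0 : 0 < q by exact: powR_gt0.
have qN : q ^+ N = eta.
  rewrite -powR_mulrn ?ltW// -powRrM mulVf ?powRr1 ?ltW//.
  by rewrite pnatr_eq0 -lt0n.
exists q; split => //; rewrite ltNge; apply/negP => q_ge1.
by have := exprn_ege1 N q_ge1; rewrite qN leNgt eta_lt1.
Qed.

Section LeastSquares.
Context {R : realType} {U : Type} (N : nat) (x : 'I_N -> U) (y : 'I_N -> R).

(** The empirical risk depends on a function only through its values at the
    sample points: when these cannot tell the candidates apart, the criterion
    is constant on the class. *)
Lemma argmin_unidentified (S : set (U -> R)) (g : U -> R) :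
  S g -> (forall h, S h -> forall i, h (x i) = g (x i)) ->
  argmin_on S (empirical_risk x y) g.
Proof.
move=> Sg Sx; split => // h Sh; rewrite /empirical_risk.
by under [X in _ <= _ * X]eq_bigr do rewrite Sx//.
Qed.

(** Comparing with the zero function bounds the residual
    [(y i - g (x i)) ^+ 2] by [\sum_k y k ^+ 2], which also bounds [y i ^+ 2];
    the constant [4] comes from [s ^+ 2 <= 2 * (a - s) ^+ 2 + 2 * a ^+ 2]. The
    bound does not involve [g]: all minimizers are controlled at once. *)
Lemma argmin_sqr_le (S : set (U -> R)) (g : U -> R) (i : 'I_N) :
  S (fun=> 0) -> argmin_on S (empirical_risk x y) g ->
  g (x i) ^+ 2 <= 4 * \sum_(k < N) y k ^+ 2.
Proof.
move=> S0 [_ /(_ _ S0)]; rewrite /empirical_risk.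
have N_gt0 : (0 < N)%N by exact: leq_ltn_trans (ltn_ord i).
rewrite ler_pM2l ?invr_gt0 ?ltr0n//.
under [X in _ <= X]eq_bigr do rewrite subr0.
have single (z : 'I_N -> R) : z i ^+ 2 <= \sum_(k < N) z k ^+ 2.
  rewrite (bigD1 i)//= lerDl; apply: sumr_ge0 => k _; exact: sqr_ge0.
have := single y; have := single (fun k => y k - g (x k)) => /=.
move: (\sum_(k < N) _) (\sum_(k < N) _) (y i) (g (x i)) => A B a s.
nra.
Qed.

End LeastSquares.

Section Spikes.
Context {R : realType}.

(** The heights [1 / j.+1] keep the functions within the unit bound and
    pairwise distinct, so that the dictionary really has [M] elements, although
    they are all proportional. *)
Definition spike (M : nat) (j : 'I_M) (x : bool) : R :=
  if x then j.+1%:R^-1 else 0.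

Lemma spike_inj (M : nat) : injective (@spike M).
Proof.
move=> i j /(congr1 (fun f => f true)) /= /invr_inj /eqP.
by rewrite eqr_nat eqSS => /eqP /val_inj.
Qed.

Lemma normr_spike_le1 (M : nat) (j : 'I_M) x : `|spike j x| <= 1.
Proof.
case: x => /=; last by rewrite normr0.
by rewrite ger0_norm ?invr_ge0// invf_le1 ?ltr0n// ler1n.
Qed.

Lemma span_spikeP (M : nat) (g : bool -> R) : (0 < M)%N ->
  dict_span (@spike M) g <-> g false = 0.
Proof.
move=> M_gt0; split => [[t ->]|g0]; first by rewrite big1// => j _; rewrite mulr0.
(* The first spike has height 1, so it spans the line alone. *)
pose j0 := Ordinal M_gt0.
exists (fun j => if j == j0 then g true else 0).
apply/funext => x; rewrite (bigD1 j0)//= [X in _ + X]big1 ?addr0 ?eqxx; last first.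
  by move=> j /negPf ->; rewrite mul0r.
by case: x; rewrite /spike/= ?invr1 ?mulr1 ?mulr0.
Qed.

Context (p : R) (p01 : 0 <= p <= 1).

Definition coin : {RV (bernoulli_prob p) >-> bool} :=
  HB.pack_for {mfun bool >-> bool} (idfun : bool -> bool)
    (isMeasurableFun.Build _ _ bool bool idfun (@measurable_id _ bool setT)).
Definition zero_response : {RV (bernoulli_prob p) >-> R} := cst 0.

Lemma risk_coin (g : bool -> R) : g false = 0 ->
  risk coin zero_response g = (p * g true ^+ 2)%:E.
Proof.
move=> g0; rewrite /risk unlock integral_bernoulli_prob//; last first.
  by move=> b; rewrite lee_fin sqr_ge0.
by rewrite /= g0 !sub0r sqrrN oppr0 expr0n/= mule0 adde0.
Qed.

Lemma inf_risk_coin (M : nat) : (0 < M)%N ->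
  ereal_inf [set risk coin zero_response g | g in dict_span (@spike M)] = 0%E.
Proof.
move=> M_gt0; apply/eqP; rewrite eq_le; apply/andP; split.
  apply: ereal_inf_lbound; exists (fun=> 0); first exact/span_spikeP.
  by rewrite risk_coin// expr0n/= mulr0.
apply: le_ereal_inf_tmp => _ [g /(span_spikeP _ M_gt0) g0 <-].
by rewrite risk_coin// lee_fin mulr_ge0 ?sqr_ge0//; case/andP: p01.
Qed.

(** An equivalence, and for arbitrary responses [y], because the responses of
    the copies of [(X, Y)] vanish only almost surely: this way the event of bad
    minimizers is identified with a measurable event everywhere on the sample
    space, with no null set left out. *)
Lemma arbitrarily_bad_argminP (M N : nat) (x : 'I_N -> bool) (y : 'I_N -> R) :
  (0 < M)%N -> 0 < p ->
  (forall kappa : R, 0 < kappa -> exists2 g : bool -> R,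
     argmin_on (dict_span (@spike M)) (empirical_risk x y) g &
     (ereal_inf [set risk coin zero_response h | h in dict_span (@spike M)]
        + kappa%:E <= risk coin zero_response g)%E)
  <-> forall i, x i = false.
Proof.
move=> M_gt0 p_gt0; have spanP g := @span_spikeP M g M_gt0.
rewrite inf_risk_coin//; split => [bad i|x0 kappa kappa_gt0].
  (* [B] bounds the risk of every minimizer, so [kappa := B + 1] fails. *)
  apply/negP => xi; pose B := 4 * \sum_(k < N) y k ^+ 2.
  have B_ge0 : 0 <= B by rewrite mulr_ge0// sumr_ge0// => k _; exact: sqr_ge0.
  have [|g g_min] := bad (B + 1); first lra.
  have g0 : g false = 0 by apply/spanP; case: g_min.
  have := argmin_sqr_le i (proj2 (spanP (fun=> 0)) erefl) g_min.
  rewrite xi -/B add0e risk_coin// lee_fin => gB.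
  have : p * g true ^+ 2 <= g true ^+ 2.
    by rewrite ler_piMl ?sqr_ge0//; case/andP: p01.
  lra.
(* The risk of [g] is [p * (1 + kappa / p) ^+ 2 >= p * (kappa / p) = kappa]. *)
pose g (b : bool) : R := if b then 1 + kappa / p else 0.
exists g.
  apply: argmin_unidentified => [|h /spanP h0 i]; first exact/spanP.
  by rewrite x0 h0.
rewrite add0e risk_coin// lee_fin /g.
have pk : p * (kappa / p) = kappa by rewrite mulrC divfK// gt_eqF.
have : 0 < kappa / p by rewrite divr_gt0.
nra.
Qed.

End Spikes.

Theorem proposition1p6 (R : realType) (eta : R) (N M : nat)
    (eta_gt0 : 0 < eta) (eta_lt1 : eta < 1) (N_gt0 : (0 < N)%N) (M_gt0 : (0 < M)%N) :
  exists (dX : measure_display) (XX : measurableType dX)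
    (d : measure_display) (Omega : measurableType d) (P : probability Omega R)
    (X : {RV P >-> XX}) (Y : {RV P >-> R}) (f : 'I_M -> XX -> R),
    [/\ injective f, (forall j, measurable_fun setT (f j)),
      {ae P, forall w, `|Y w| <= 1} /\
        (forall j, {ae P, forall w, `|f j (X w)| <= 1}) &
      forall (d' : measure_display) (Omega' : measurableType d')
        (P' : probability Omega' R)
        (Xs : 'I_N -> {RV P' >-> XX}) (Ys : 'I_N -> {RV P' >-> R}),
        iid_copies X Y Xs Ys ->
        let E := [set w : Omega' | forall kappa : R, 0 < kappa ->
          exists2 fhat : XX -> R,
            argmin_on (dict_span f)
              (empirical_risk (fun i => Xs i w) (fun i => Ys i w)) fhat &
            (ereal_inf [set risk X Y g | g in dict_span f] + kappa%:E
               <= risk X Y fhat)%E] in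
        measurable E /\ (eta%:E <= P' E)%E].
Proof.
have [q [q_gt0 q_lt1 qN]] := exists_root_in_unit_interval eta_gt0 eta_lt1 N_gt0.
have p_gt0 : 0 < 1 - q by lra.
have p01 : 0 <= 1 - q <= 1 by apply/andP; split; lra.
exists _, bool, _, bool, (bernoulli_prob (1 - q)), (coin _), (zero_response _).
exists (@spike R M); split => //.
- exact: spike_inj.
- split=> [|j]; apply/aeW => w /=; first by rewrite normr0.
  exact: normr_spike_le1.
move=> d' Omega' P' Xs Ys [law indep] E.
pose B : set (bool * R) := [set false] `*` setT.
have mB : measurable B by exact: measurableX.
have EE : E = \bigcap_(i in [set` [set: 'I_N]%SET])
    ((fun w => (Xs i w, Ys i w)) @^-1` B).
  apply/seteqP; split => w.
    move=> /(arbitrarily_bad_argminP p01 _ _ M_gt0 p_gt0) Xs0 i _.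
    by split => //=; exact: Xs0.
  move=> Xs0; apply/(arbitrarily_bad_argminP p01 _ _ M_gt0 p_gt0) => i.
  by have [] := Xs0 i; rewrite /= ?inE.
have PB i : P' ((fun w => (Xs i w, Ys i w)) @^-1` B) = q%:E.
  rewrite law// (_ : _ @^-1` B = [set false]); last first.
    by apply/seteqP; split => b //= [].
  transitivity (bernoulli_prob (1 - q) [set false]); first by [].
  rewrite (bernoulli_probE p01) !diracE.
  rewrite memNset ?mem_set//= mule0 add0e mule1.
  by congr EFin; exact: subKr.
split.
  rewrite EE; apply: fin_bigcap_measurable => // i _.
  have mZ : measurable_fun setT (fun w => (Xs i w, Ys i w)).
    by apply/measurable_fun_pairP; split; exact: measurable_funP.
  by rewrite -[X in measurable X]setTI; exact: mZ.
rewrite EE indep//; under eq_bigr do rewrite PB.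
by rewrite prodEFin prodr_const cardsT card_ord qN.
Qed.
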